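(* Let $G$ be a regular Lie group with Lie algebra $\mathfrak g=\mathbf T_eG$. For all $X,Y\in\mathfrak g$ and all $d_1,d_2,d_3,d_4\in D$, writing $s=d_1+d_2+d_3+d_4$, $$\exp\big(s(X+Y)\big)=\exp(sX).\exp(sY).\exp\big(-(d_1d_2+d_1d_3+d_1d_4+d_2d_3+d_2d_4+d_3d_4)[X,Y]\big).$$ $$\exp\big((d_1d_2d_3+d_1d_2d_4+d_1d_3d_4+d_2d_3d_4)[X+2Y,[X,Y]]\big).\exp\Big(d_1d_2d_3d_4\big(-[X,[X,[X,Y]]]-3[X,[Y,[X,Y]]]-3[Y,[Y,[X,Y]]]\big)\Big)$$ (the two displayed lines being one single product), and this is also equal to $$\exp(sX).\exp(sY).\exp\Big(-\frac{s^2}{2}[X,Y]\Big).\exp\Big(\frac{s^3}{6}[X+2Y,[X,Y]]\Big).\exp\Big(\frac{s^4}{24}\big(-[X,[X,[X,Y]]]-3[X,[Y,[X,Y]]]-3[Y,[Y,[X,Y]]]\big)\Big).$$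
   Context: We work in synthetic differential geometry. $\mathbb R$ is the line: a commutative ring in which positive integers are invertible, satisfying the (general) Kock-Lawvere axiom. $D=\{d\in\mathbb R\mid d^2=0\}$. A space $M$ is microlinear if every finite diagram of infinitesimal spaces that $\mathbb R$ perceives as a colimit is also perceived as a colimit by $M$. A Lie group is a group which is microlinear as a space; its unit is $e$ and its product is written with a dot. $\mathfrak g=\mathbf T_eG$ is the set of maps $X:D\to G$, $d\mapsto X_d$, with $X_0=e$; it is an $\mathbb R$-module with $(\alpha X)_d=X_{\alpha d}$ and $(X+Y)_d=X_d.Y_d=Y_d.X_d$, and a Lie algebra whose bracket $[X,Y]$ is the unique element of $\mathfrak g$ with $X_{d_1}.Y_{d_2}.X_{-d_1}.Y_{-d_2}=[X,Y]_{d_1d_2}$ for all $d_1,d_2\in D$. A Lie group $G$ is regular if for every map $\varsigma:\mathbb R\to\mathfrak g$ there is a map $\theta:\mathbb R\to G$ with $\theta(0)=e$ and $\theta(t+d)=\theta(t).\varsigma(t)_d$ for all $t\in\mathbb R$, $d\in D$. For $X\in\mathfrak g$, if $\theta:\mathbb R\to G$ is a one-parameter subgroup (a homomorphism from the additive group of $\mathbb R$) with $\theta(d)=X_d$ for all $d\in D$, then $\exp X$ denotes $\theta(1)$; when $G$ is regular, $\exp:\mathfrak g\to G$ is a total function. *)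

(* Defs.v *)
(** Synthetic differential geometry, in plain Rocq with the standard library.

    The line of synthetic differential geometry has no decidable equality, and
    the Kock-Lawvere axiom is refuted by case distinction on [d = 0].  The
    algebraic hierarchies whose carriers are discrete (such as those with a
    choice structure) are therefore unusable here: rings and groups are
    rebuilt over arbitrary types.  Function and subset types play the role of
    exponentials and subobjects in the ambient topos; maps are compared
    pointwise wherever possible. *)

From Stdlib Require Import List Ring_theory Fin.
Import ListNotations.

Set Implicit Arguments.
Unset Strict Implicit.
Unset Printing Implicit Defensive.

Declare Scope line_scope.
Delimit Scope line_scope with line.
Declare Scope lie_scope.
Delimit Scope lie_scope with lie.
Declare Scope tangent_scope.
Delimit Scope tangent_scope with tangent.

Record comm_ring : Type := CommRing {
  cr_car :> Type;
  cr_zero : cr_car;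
  cr_one : cr_car;
  cr_add : cr_car -> cr_car -> cr_car;
  cr_mul : cr_car -> cr_car -> cr_car;
  cr_sub : cr_car -> cr_car -> cr_car;
  cr_opp : cr_car -> cr_car;
  cr_theory :
    ring_theory cr_zero cr_one cr_add cr_mul cr_sub cr_opp (@eq cr_car)
}.

Arguments cr_zero {c}.
Arguments cr_one {c}.
Bind Scope line_scope with cr_car.

Notation "0" := cr_zero : line_scope.
Notation "1" := cr_one : line_scope.
Notation "x + y" := (cr_add x y) : line_scope.
Notation "x * y" := (cr_mul x y) : line_scope.
Notation "x - y" := (cr_sub x y) : line_scope.
Notation "- x" := (cr_opp x) : line_scope.

Fixpoint natr (A : comm_ring) (n : nat) : A :=
  match n with
  | O => 0%line
  | S m => (1 + natr A m)%line
  end.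

Fixpoint power (A : comm_ring) (x : A) (n : nat) : A :=
  match n with
  | O => 1%line
  | S m => (x * power x m)%line
  end.

Notation "x ^ n" := (power x n%nat) : line_scope.

Definition product (A : comm_ring) (l : list A) : A := fold_right (@cr_mul A) 1%line l.

Definition is_ring_hom (A B : comm_ring) (f : A -> B) : Prop :=
  f 1%line = 1%line
  /\ (forall x y, f (x + y) = f x + f y)%line
  /\ (forall x y, f (x * y) = f x * f y)%line.

Record algebra (R : comm_ring) : Type := Algebra {
  alg_ring :> comm_ring;
  alg_scalar : R -> alg_ring;
  alg_scalar_hom : is_ring_hom alg_scalar
}.

(** The augmentation of an algebra, and more generally any [R]-point of it. *)
Definition is_point (R : comm_ring) (W : algebra R) (phi : W -> R) : Prop :=
  is_ring_hom phi /\ forall a : R, phi (alg_scalar W a) = a.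

(** Coefficient and generator lists are always used with equal lengths. *)
Fixpoint lincomb (R : comm_ring) (W : algebra R) (c : list R) (b : list W) : W :=
  match c, b with
  | a :: c', x :: b' => (alg_scalar W a * x + lincomb c' b')%line
  | _, _ => 0%line
  end.

(** An augmented algebra whose augmentation ideal is nilpotent and free of
    finite rank; as a module the algebra is then the direct sum of [R] and
    this ideal. *)
Record weil_algebra (R : comm_ring) : Type := WeilAlgebra {
  weil_alg :> algebra R;
  weil_aug : weil_alg -> R;
  weil_aug_point : is_point weil_aug;
  weil_nilpotent :
    exists N : nat, forall l : list weil_alg,
      length l = N -> Forall (fun w => weil_aug w = 0%line) l ->
      product l = 0%line;
  weil_free :
    exists b : list weil_alg,
      Forall (fun w => weil_aug w = 0%line) b
      /\ forall w : weil_alg, weil_aug w = 0%line ->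
           exists! c : list R, length c = length b /\ w = lincomb c b
}.

(** The infinitesimal space of a Weil algebra is the space of its [R]-points. *)
Definition Spec (R : comm_ring) (W : weil_algebra R) : Type :=
  {phi : W -> R | is_point phi}.

(** For every Weil algebra [W], the canonical map from [W] to the maps
    [Spec W -> R], given by evaluation, is bijective. *)
Definition kock_lawvere (R : comm_ring) : Prop :=
  forall (W : weil_algebra R) (f : Spec W -> R),
    exists! w : W, forall phi : Spec W, f phi = proj1_sig phi w.

Record line : Type := Line {
  line_ring :> comm_ring;
  line_inv : nat -> line_ring;  (** the value at [0] is irrelevant *)
  line_invP : forall n : nat, n <> 0 -> (natr line_ring n * line_inv n = 1)%line;
  line_kock_lawvere : kock_lawvere line_ring
}.

Notation "x / n" := (cr_mul x (line_inv _ n%nat)) : line_scope.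

(** A finite diagram (indexed by a finite graph) of infinitesimal spaces,
    together with a cocone under it whose vertex is an infinitesimal space. *)
Record cocone (R : comm_ring) : Type := Cocone {
  cc_nodes : nat;
  cc_arrows : nat;
  cc_obj : Fin.t cc_nodes -> weil_algebra R;
  cc_src : Fin.t cc_arrows -> Fin.t cc_nodes;
  cc_tgt : Fin.t cc_arrows -> Fin.t cc_nodes;
  cc_map : forall a : Fin.t cc_arrows,
    Spec (cc_obj (cc_src a)) -> Spec (cc_obj (cc_tgt a));
  cc_vertex : weil_algebra R;
  cc_leg : forall i : Fin.t cc_nodes, Spec (cc_obj i) -> Spec cc_vertex;
  cc_commutes : forall (a : Fin.t cc_arrows) (x : Spec (cc_obj (cc_src a))),
    cc_leg (cc_map x) = cc_leg x
}.

(** [M] perceives the cocone as a colimit: mapping into [M] turns it into a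
    limit cone. *)
Definition perceives_colimit (R : comm_ring) (M : Type) (C : cocone R) : Prop :=
  forall f : (forall i : Fin.t (cc_nodes C), Spec (cc_obj i) -> M),
    (forall a x, f (cc_tgt a) (cc_map x) = f (cc_src a) x) ->
    exists g : Spec (cc_vertex C) -> M,
      (forall i x, g (cc_leg x) = f i x)
      /\ forall g' : Spec (cc_vertex C) -> M,
           (forall i x, g' (cc_leg x) = f i x) -> forall z, g' z = g z.

Definition microlinear (R : comm_ring) (M : Type) : Prop :=
  forall C : cocone R, perceives_colimit R C -> perceives_colimit M C.

Record group : Type := Group {
  gr_car :> Type;
  gr_unit : gr_car;
  gr_mul : gr_car -> gr_car -> gr_car;
  gr_inv : gr_car -> gr_car;
  gr_mulA : forall x y z, gr_mul x (gr_mul y z) = gr_mul (gr_mul x y) z;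
  gr_mul1l : forall x, gr_mul gr_unit x = x;
  gr_mul1r : forall x, gr_mul x gr_unit = x;
  gr_mulVl : forall x, gr_mul (gr_inv x) x = gr_unit;
  gr_mulVr : forall x, gr_mul x (gr_inv x) = gr_unit
}.

Arguments gr_unit {g}.
Bind Scope lie_scope with gr_car.

Notation "x ** y" := (gr_mul x y) (at level 40, left associativity) : lie_scope.

Record lie_group (R : comm_ring) : Type := LieGroup {
  lg_group :> group;
  lg_microlinear : microlinear R lg_group
}.

Definition D (R : comm_ring) : Type := {d : R | (d * d = 0)%line}.

Definition Dval (R : comm_ring) (d : D R) : R := proj1_sig d.
Coercion Dval : D >-> cr_car.

Lemma mul_zero_r (R : comm_ring) (x : R) : (x * 0 = 0)%line.
Proof.
  pose proof (cr_theory R) as H.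
  assert (E : (x * 0 + x * 0 = x * 0)%line).
  { rewrite !(Rmul_comm H x), <- (Rdistr_l H). now rewrite (Radd_0_l H). }
  transitivity (x * 0 + (x * 0 + - (x * 0)))%line.
  - now rewrite (Ropp_def H), (Radd_comm H), (Radd_0_l H).
  - now rewrite (Radd_assoc H), E, (Ropp_def H).
Qed.

Lemma Dscale_subproof (R : comm_ring) (a : R) (d : D R) :
  ((a * d) * (a * d) = 0)%line.
Proof.
  pose proof (cr_theory R) as H.
  rewrite (Rmul_comm H a d) at 1.
  rewrite <- (Rmul_assoc H), (Rmul_assoc H a a), (Rmul_comm H (a * a)%line).
  rewrite (Rmul_assoc H). unfold Dval. rewrite (proj2_sig d).
  now rewrite (Rmul_comm H), mul_zero_r.
Qed.

Definition Dscale (R : comm_ring) (a : R) (d : D R) : D R :=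
  exist _ (a * d)%line (Dscale_subproof a d).

(** Stating the base point condition for every [d] of value [0] makes it
    independent of the proof that [0] has square zero. *)
Record tangent (R : comm_ring) (G : lie_group R) : Type := Tangent {
  tan_fun :> D R -> G;
  tan_base : forall d : D R, Dval d = 0%line -> tan_fun d = gr_unit
}.

Bind Scope tangent_scope with tangent.

Lemma tscale_subproof (R : comm_ring) (G : lie_group R) (a : R) (X : tangent G) :
  forall d : D R, Dval d = 0%line -> X (Dscale a d) = gr_unit.
Proof.
  intros d Hd. apply tan_base. cbn. rewrite Hd. apply mul_zero_r.
Qed.

Definition tscale (R : comm_ring) (G : lie_group R) (a : R) (X : tangent G) :
  tangent G :=
  Tangent (tscale_subproof a X).

Lemma tadd_subproof (R : comm_ring) (G : lie_group R) (X Y : tangent G) :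
  forall d : D R, Dval d = 0%line -> (X d ** Y d)%lie = gr_unit.
Proof.
  intros d Hd. rewrite !tan_base by assumption. apply gr_mul1l.
Qed.

Definition tadd (R : comm_ring) (G : lie_group R) (X Y : tangent G) : tangent G :=
  Tangent (tadd_subproof X Y).

Notation "a *: X" := (tscale a%line X)
  (at level 40, left associativity) : tangent_scope.
Notation "X + Y" := (tadd X Y) : tangent_scope.
Notation "- X" := (tscale (- (1))%line X) : tangent_scope.
Notation "X - Y" := (tadd X (tscale (- (1))%line Y)) : tangent_scope.

(** [br] is determined by this property, since [G] is microlinear: an element
    of the tangent space is determined by its values at the products [d1 d2]. *)
Definition is_lie_bracket (R : comm_ring) (G : lie_group R)
    (br : tangent G -> tangent G -> tangent G) : Prop :=
  forall (X Y : tangent G) (d1 d2 : D R),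
    (X d1 ** Y d2 ** X (Dscale (- (1)) d1) ** Y (Dscale (- (1)) d2))%lie
    = br X Y (Dscale d1 d2).

Definition regular (R : comm_ring) (G : lie_group R) : Prop :=
  forall sigma : R -> tangent G,
    exists theta : R -> G,
      theta 0%line = gr_unit
      /\ forall (t : R) (d : D R),
           theta (t + d)%line = (theta t ** sigma t d)%lie.

Definition is_one_parameter_subgroup (R : comm_ring) (G : lie_group R)
    (theta : R -> G) : Prop :=
  forall s t : R, theta (s + t)%line = (theta s ** theta t)%lie.

Definition generates (R : comm_ring) (G : lie_group R)
    (X : tangent G) (theta : R -> G) : Prop :=
  is_one_parameter_subgroup theta /\ forall d : D R, theta d = X d.

(** [exp] is the total exponential map: every tangent vector generates a
    one-parameter subgroup, and [exp X] is the value at [1] of any such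
    subgroup.  Regularity as defined above asserts only that solutions exist;
    it does not by itself make [theta 1] independent of [theta]. *)
Definition is_exponential (R : comm_ring) (G : lie_group R)
    (exp : tangent G -> G) : Prop :=
  forall X : tangent G,
    (exists theta : R -> G, generates X theta)
    /\ forall theta : R -> G, generates X theta -> exp X = theta 1%line.

(* Main.v *)
(** [expt A r = exp (r A)] is additive in [r], so that every factor of the
    identity is a product of elements [W_u], with [W] an iterated bracket of [X]
    and [Y] and [u] an integer multiple of a square-free monomial in
    [d1, ..., d4].  By the definition of the bracket,
    [W_v V_u = V_u W_v [V, W]_(- u v)], and the correction vanishes if [u] and
    [v] share an infinitesimal.  Hall's collection process with this rule
    therefore terminates after monomials of degree four; carried out by
    computation, it brings both sides to the same normal form, once the Jacobi
    identity has replaced [[X, [Y, [X, Y]]]] by [[Y, [X, [X, Y]]]].  The second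
    product equals the first because [s^k / k!] is the [k]-th elementary
    symmetric polynomial of the [di]. *)

From Stdlib Require Import List Ring InitialRing ZArith Bool.
Require Import Defs.
Import ListNotations.

Set Implicit Arguments.
Unset Strict Implicit.
Unset Printing Implicit Defensive.

(** * Collection of Lie words carrying square-free monomials *)

Inductive lie_word : Type :=
| Gen (b : bool)
| Br (u v : lie_word).

Fixpoint word_eqb (u v : lie_word) : bool :=
  match u, v with
  | Gen b, Gen c => Bool.eqb b c
  | Br u1 u2, Br v1 v2 => word_eqb u1 v1 && word_eqb u2 v2
  | _, _ => false
  end.

Lemma word_eqb_eq (u v : lie_word) : word_eqb u v = true -> u = v.
Proof.
  revert v. induction u as [b | u1 IH1 u2 IH2]; intros [c | v1 v2]; cbn;
    try discriminate.
  - intros H. now apply eqb_prop in H as ->.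
  - intros H. apply andb_true_iff in H as [H1 H2].
    now rewrite (IH1 _ H1), (IH2 _ H2).
Qed.

(** The order in which letters are collected.  Nothing depends on it except
    whether [collect] brings equal products to the same form. *)
Fixpoint word_rank (u : lie_word) : Z :=
  match u with
  | Gen b => if b then 2 else 1
  | Br u v => word_rank u + 3 * word_rank v
  end.

(** A square-free monomial in the infinitesimals is the list of its exponents. *)
Fixpoint mono_eqb (m m' : list bool) : bool :=
  match m, m' with
  | [], [] => true
  | b :: m, c :: m' => Bool.eqb b c && mono_eqb m m'
  | _, _ => false
  end.

Lemma mono_eqb_eq (m m' : list bool) : mono_eqb m m' = true -> m = m'.
Proof.
  revert m'. induction m as [| b m IH]; intros [| c m']; cbn;
    try discriminate; trivial.
  intros H. apply andb_true_iff in H as [H1 H2].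
  now rewrite (IH _ H2), (eqb_prop _ _ H1).
Qed.

Fixpoint mono_ltb (m m' : list bool) : bool :=
  match m, m' with
  | b :: m, c :: m' => b && negb c || Bool.eqb b c && mono_ltb m m'
  | _, _ => false
  end.

(** [None] stands for the zero product. *)
Fixpoint mono_mul (m m' : list bool) : option (list bool) :=
  match m, m' with
  | [], _ => Some m'
  | _, [] => Some m
  | b :: m, c :: m' =>
      if b && c then None else option_map (cons (b || c)) (mono_mul m m')
  end.

(** Fails exactly when no infinitesimal occurs in [m]; otherwise the value of [m] squares to zero,
    as exchanging two factors by means of a bracket demands. *)
Definition mono_nilpotent (m : list bool) : bool :=
  match mono_mul m m with None => true | Some _ => false end.

(** The group element [W_(k m)], for a Lie word [W], an integer [k] and a
    monomial [m]. *)
Record letter : Type := Letter {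
  lt_word : lie_word;
  lt_coef : Z;
  lt_mono : list bool
}.

Definition letter_ltb (a b : letter) : bool :=
  Z.ltb (word_rank (lt_word a)) (word_rank (lt_word b))
  || word_eqb (lt_word a) (lt_word b) && mono_ltb (lt_mono a) (lt_mono b).

Definition same_key (a b : letter) : bool :=
  word_eqb (lt_word a) (lt_word b) && mono_eqb (lt_mono a) (lt_mono b).

Definition merge (a b : letter) (l : list letter) : list letter :=
  let k := (lt_coef a + lt_coef b)%Z in
  if Z.eqb k 0 then l else Letter (lt_word a) k (lt_mono a) :: l.

Definition swappable (a b : letter) : bool :=
  word_eqb (lt_word a) (lt_word b)
  || mono_nilpotent (lt_mono a) && mono_nilpotent (lt_mono b).

(** The correction [c] in [a b = b a c]. *)
Definition commutator (a b : letter) : list letter :=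
  if word_eqb (lt_word a) (lt_word b) then [] else
  match mono_mul (lt_mono b) (lt_mono a) with
  | None => []
  | Some m =>
      [Letter (Br (lt_word b) (lt_word a)) (- (lt_coef b * lt_coef a)) m]
  end.

(** Stopping early, when the fuel [n] runs out or two letters cannot be
    swapped, still leaves a list with the right product. *)
Fixpoint insert (n : nat) (a : letter) (l : list letter) : list letter :=
  match n, l with
  | S n, b :: l' =>
      if same_key a b then merge a b l'
      else if letter_ltb a b then a :: l
      else if swappable a b then
        b :: insert n a (fold_right (insert n) l' (commutator a b))
      else a :: l
  | _, _ => a :: l
  end.

Definition collect (n : nat) (l : list letter) : list letter :=
  fold_right (insert n) [] l.

Section Groups.

Local Open Scope lie_scope.

Variable G : group.

Lemma mulKr (x y : G) : x ** y ** gr_inv y = x.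
Proof. now rewrite <- gr_mulA, gr_mulVr, gr_mul1r. Qed.

Lemma mul_cancel_r (x y z : G) : x ** z = y ** z -> x = y.
Proof. intros H. now rewrite <- (mulKr x z), H, mulKr. Qed.

End Groups.

Lemma Dval_sq (R : comm_ring) (d : D R) : (d * d = 0)%line.
Proof. exact (proj2_sig d). Qed.

(** * Powers of a sum of four square-zero elements *)

Section Line.

Variable R : line.

Add Ring line_ring_R : (cr_theory R).

Local Open Scope line_scope.

Lemma divE (n : nat) (x y : R) : n <> 0%nat -> x = natr R n * y -> x / n = y.
Proof.
  intros Hn ->. transitivity (natr R n * line_inv R n * y); [ring|].
  rewrite (line_invP R Hn). ring.
Qed.

(** In the multinomial expansion of $s^k$ only the square-free monomials survive, each with
    coefficient $k!$, which [divE] cancels. *)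
Lemma power_sum4 (d1 d2 d3 d4 : D R) :
  let s := d1 + d2 + d3 + d4 in
  s ^ 2 / 2 = d1 * d2 + d1 * d3 + d1 * d4 + d2 * d3 + d2 * d4 + d3 * d4
  /\ s ^ 3 / 6 = d1 * d2 * d3 + d1 * d2 * d4 + d1 * d3 * d4 + d2 * d3 * d4
  /\ s ^ 4 / 24 = d1 * d2 * d3 * d4.
Proof.
  pose proof (Dval_sq d1) as H1. pose proof (Dval_sq d2) as H2.
  pose proof (Dval_sq d3) as H3. pose proof (Dval_sq d4) as H4.
  repeat split; apply divE; try discriminate; cbn; ring [H1 H2 H3 H4].
Qed.

End Line.

(** * One-parameter subgroups and their commutation at square-zero parameters *)

Section Exponential.

Variables (R : line) (G : lie_group R).
Variables (exp : tangent G -> G) (exp_spec : is_exponential exp).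
Variables (br : tangent G -> tangent G -> tangent G)
          (br_spec : is_lie_bracket br).

Add Ring exp_ring_R : (cr_theory R).

Local Open Scope line_scope.

(** The canonical ring homomorphism from $\mathbb Z$ to $\mathbb R$. *)
Notation inj := (gen_phiZ (@cr_zero R) cr_one (@cr_add R) (@cr_mul R) (@cr_opp R)).

Let inj_morph := gen_phiZ_morph (Eqsth R)
  (Eq_ext (@cr_add R) (@cr_mul R) (@cr_opp R)) (cr_theory R).

Definition expt (A : tangent G) (r : R) : G := exp (r *: A)%tangent.

(** The map $t\mapsto\theta(rt)$ generates $rA$, and its value at $1$ is $\theta(r)$. *)
Lemma exptE (A : tangent G) (theta : R -> G) (r : R) :
  generates A theta -> expt A r = theta r.
Proof.
  intros [Hadd HD].
  destruct (exp_spec (r *: A)%tangent) as [_ H].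
  unfold expt. rewrite (H (fun t => theta (r * t))).
  - f_equal. ring.
  - split.
    + intros s t. rewrite <- Hadd. f_equal. ring.
    + intros d. exact (HD (Dscale r d)).
Qed.

Lemma exptD (A : tangent G) (r s : R) :
  expt A (r + s) = (expt A r ** expt A s)%lie.
Proof.
  destruct (exp_spec A) as [[theta H] _].
  rewrite !(exptE _ H). apply (proj1 H).
Qed.

Lemma expt_inf (A : tangent G) (d : D R) : expt A d = A d.
Proof.
  destruct (exp_spec A) as [[theta H] _].
  rewrite (exptE _ H). apply (proj2 H).
Qed.

Lemma exptZ (A : tangent G) (a r : R) : expt (a *: A)%tangent r = expt A (a * r).
Proof.
  destruct (exp_spec A) as [[theta H] _].
  rewrite (exptE _ H), (@exptE _ (fun t => theta (a * t))); trivial.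
  split.
  - intros s t. rewrite <- (proj1 H). f_equal. ring.
  - intros d. exact (proj2 H (Dscale a d)).
Qed.

Lemma expt0 (A : tangent G) : expt A 0 = gr_unit.
Proof.
  apply (@mul_cancel_r G _ _ (expt A 0)).
  rewrite <- exptD, gr_mul1l. f_equal. ring.
Qed.

Lemma exptC (A : tangent G) (r s : R) :
  (expt A r ** expt A s = expt A s ** expt A r)%lie.
Proof. rewrite <- !exptD. f_equal. ring. Qed.

Lemma exptN (A : tangent G) (r : R) : (expt A r ** expt A (- r))%lie = gr_unit.
Proof. rewrite <- exptD, <- (expt0 A). f_equal. ring. Qed.

Lemma exptK (A : tangent G) (r : R) (x : G) :
  (x ** expt A r ** expt A (- r))%lie = x.
Proof. now rewrite <- gr_mulA, exptN, gr_mul1r. Qed.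

Lemma exptNK (A : tangent G) (r : R) (x : G) :
  (x ** expt A (- r) ** expt A r)%lie = x.
Proof. now rewrite <- gr_mulA, exptC, exptN, gr_mul1r. Qed.

(** Addition of tangent vectors is the pointwise product on $D$, hence the restriction to
    square-zero [r]. *)
Lemma expt_tadd (A B : tangent G) (r : R) :
  r * r = 0 -> expt (A + B)%tangent r = (expt A r ** expt B r)%lie.
Proof.
  intros Hr. pose (d := exist _ r Hr : D R).
  change r with (Dval d). now rewrite !expt_inf.
Qed.

Lemma expt_br (A B : tangent G) (r s : R) :
  r * r = 0 -> s * s = 0 ->
  expt (br A B) (r * s)
  = (expt A r ** expt B s ** expt A (- r) ** expt B (- s))%lie.
Proof.
  intros Hr Hs. pose (d := exist _ r Hr : D R). pose (e := exist _ s Hs : D R).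
  change (r * s) with (Dval (Dscale d e)). rewrite expt_inf, <- br_spec.
  rewrite <- !expt_inf. cbn.
  now replace (- (1) * r) with (- r) by ring; replace (- (1) * s) with (- s) by ring.
Qed.

(** Since $rs=(-r)(-s)$, the bracket at $rs$ is $A_{-r}.B_{-s}.A_r.B_s$, whose first two factors
    cancel $B_s.A_r$. *)
Lemma expt_swap (A B : tangent G) (r s : R) :
  r * r = 0 -> s * s = 0 ->
  (expt B s ** expt A r = expt A r ** expt B s ** expt (br A B) (- (r * s)))%lie.
Proof.
  intros Hr Hs. apply (@mul_cancel_r G _ _ (expt (br A B) (r * s))).
  rewrite exptNK. replace (r * s) with (- r * - s) by ring.
  rewrite expt_br by (ring [Hr Hs]).
  replace (- - r) with r by ring. replace (- - s) with s by ring.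
  now rewrite !gr_mulA, !exptK, exptN, gr_mul1l.
Qed.

(** The conjugation $A_r.B_s.A_{-r}=[A,B]_{rs}.B_s$, with the correction on the left. *)
Lemma expt_conj (A B : tangent G) (r s : R) :
  r * r = 0 -> s * s = 0 ->
  (expt A r ** expt B s = expt (br A B) (r * s) ** expt B s ** expt A r)%lie.
Proof.
  intros Hr Hs. now rewrite expt_br, !exptNK.
Qed.

(** For [Z = [X, Y]], conjugating [Z_c] by [X_a Y_b] and by [Y_b X_a] gives the
    same result, since [X_a Y_b = Y_b X_a Z_(ab)] and [Z_(ab)] commutes with
    [Z_c]. *)
Lemma expt_jacobi (X Y : tangent G) (a b c : R) :
  a * a = 0 -> b * b = 0 -> c * c = 0 ->
  expt (br X (br Y (br X Y))) (a * (b * c))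
  = expt (br Y (br X (br X Y))) (a * (b * c)).
Proof.
  intros Ha Hb Hc. set (Z := br X Y).
  assert (Hac : a * c * (a * c) = 0) by ring [Ha].
  assert (Hbc : b * c * (b * c) = 0) by ring [Hb].
  assert (HX : (expt X a ** expt Y b ** expt Z c
    = expt (br X (br Y Z)) (a * (b * c)) ** expt (br Y Z) (b * c)
      ** expt (br X Z) (a * c) ** expt Z c ** expt X a ** expt Y b)%lie).
  { rewrite <- gr_mulA, expt_conj by assumption.
    rewrite !gr_mulA, (@expt_conj X (br Y Z)) by assumption.
    rewrite <- !gr_mulA. do 2 f_equal. rewrite !gr_mulA. f_equal.
    now apply expt_conj. }
  assert (HY : (expt Y b ** expt X a ** expt Z c
    = expt (br Y (br X Z)) (a * (b * c)) ** expt (br X Z) (a * c)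
      ** expt (br Y Z) (b * c) ** expt Z c ** expt Y b ** expt X a)%lie).
  { rewrite <- gr_mulA, expt_conj by assumption.
    rewrite !gr_mulA, (@expt_conj Y (br X Z)) by assumption.
    replace (b * (a * c)) with (a * (b * c)) by ring.
    rewrite <- !gr_mulA. do 2 f_equal. rewrite !gr_mulA. f_equal.
    now apply expt_conj. }
  (* Both parameters contain $c$, so their product, and with it the correction, vanishes. *)
  assert (Hcomm : (expt (br X Z) (a * c) ** expt (br Y Z) (b * c)
    = expt (br Y Z) (b * c) ** expt (br X Z) (a * c))%lie).
  { rewrite expt_swap by assumption.
    replace (- (b * c * (a * c))) with (0 : R) by ring [Hc].
    now rewrite expt0, gr_mul1r. }
  assert (HZ : (expt X a ** expt Y b = expt Y b ** expt X a ** expt Z (a * b))%lie).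
  { rewrite (@expt_swap X Y) by assumption.
    now rewrite exptNK. }
  (* The left side becomes $Y_b.X_a.Z_c.Z_{ab}$, to which [HY] applies. Once the commuting middle
     factors are exchanged and $Y_b.X_a.Z_{ab}$ is folded back into $X_a.Y_b$, the two sides differ
     only in their first factor. *)
  rewrite HZ, <- gr_mulA, exptC, gr_mulA, HY, <- !gr_mulA in HX.
  rewrite (gr_mulA (expt (br X Z) _)), Hcomm, <- !gr_mulA in HX.
  rewrite (gr_mulA (expt Y b)), <- HZ in HX.
  symmetry. exact (mul_cancel_r HX).
Qed.

(** An exponent without a matching infinitesimal is ignored if it is [false],
    and makes the monomial vanish otherwise. *)
Fixpoint mono_val (e : list R) (m : list bool) : R :=
  match m, e with
  | [], _ => 1
  | b :: m, [] => if b then 0 else mono_val [] m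
  | b :: m, x :: e => (if b then x else 1) * mono_val e m
  end.

Lemma mono_mulP (e : list R) (m m' : list bool) :
  Forall (fun x => x * x = 0) e ->
  mono_val e m * mono_val e m'
  = match mono_mul m m' with Some u => mono_val e u | None => 0 end.
Proof.
  intros He. revert m m'. induction He as [| x e Hx He IHe]; intros m m'.
  - revert m'. induction m as [| b m IH]; intros m'; [cbn; ring|].
    destruct m' as [| c m']; [cbn; ring|]. specialize (IH m').
    destruct b, c; cbn; [ring|..];
      destruct (mono_mul m m'); cbn in *; rewrite ?IH; ring.
  - destruct m as [| b m]; [cbn; ring|].
    destruct m' as [| c m']; [cbn; ring|]. specialize (IHe m m').
    destruct b, c; cbn; [ring [Hx]|..];
      destruct (mono_mul m m'); cbn; ring [IHe].
Qed.

(** * Collection preserves the product in the group *)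

Section Words.

Variables (X Y : tangent G) (env : list R).
Hypothesis env_inf : Forall (fun x => x * x = 0) env.

Fixpoint word_tan (u : lie_word) : tangent G :=
  match u with
  | Gen b => if b then Y else X
  | Br u v => br (word_tan u) (word_tan v)
  end.

Definition letter_val (a : letter) : G :=
  expt (word_tan (lt_word a)) (inj (lt_coef a) * mono_val env (lt_mono a)).

Fixpoint word_val (l : list letter) : G :=
  match l with
  | [] => gr_unit
  | a :: l => (letter_val a ** word_val l)%lie
  end.

Lemma mono_nilpotentP (k : Z) (m : list bool) :
  mono_nilpotent m = true ->
  inj k * mono_val env m * (inj k * mono_val env m) = 0.
Proof.
  unfold mono_nilpotent. pose proof (mono_mulP m m env_inf) as H.
  destruct (mono_mul m m); [discriminate|]. intros _. ring [H].
Qed.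

Lemma mergeP (a b : letter) (l : list letter) :
  same_key a b = true ->
  word_val (merge a b l) = (letter_val a ** (letter_val b ** word_val l))%lie.
Proof.
  destruct a as [w k m], b as [v j m']. unfold same_key, merge; cbn.
  intros H. apply andb_true_iff in H as [Hw Hm].
  apply word_eqb_eq in Hw as <-. apply mono_eqb_eq in Hm as <-.
  rewrite gr_mulA. unfold letter_val at 1 2; cbn.
  rewrite <- exptD, <- (Rdistr_l (cr_theory R)), <- (morph_add inj_morph).
  destruct (Z.eqb_spec (k + j) 0) as [-> |]; [|reflexivity].
  rewrite (morph0 inj_morph). replace (0 * mono_val env m) with (0 : R) by ring.
  now rewrite expt0, gr_mul1l.
Qed.

(** Letters with equal words lie in a single one-parameter subgroup; for the others [expt_swap]
    yields the correction, which is trivial when the monomials share an infinitesimal. *)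
Lemma commutatorP (a b : letter) :
  swappable a b = true ->
  (letter_val a ** letter_val b
   = letter_val b ** (letter_val a ** word_val (commutator a b)))%lie.
Proof.
  destruct a as [w k m], b as [v j m']. unfold swappable, commutator; cbn.
  destruct (word_eqb w v) eqn:Hw; cbn.
  - intros _. apply word_eqb_eq in Hw as <-. rewrite gr_mul1r. apply exptC.
  - intros H. apply andb_true_iff in H as [Hm Hm'].
    unfold letter_val at 1 2 3 4; cbn.
    rewrite expt_swap by now apply mono_nilpotentP.
    rewrite <- gr_mulA. do 2 f_equal.
    replace (- (inj j * mono_val env m' * (inj k * mono_val env m)))
      with (inj (- (j * k)) * (mono_val env m' * mono_val env m)).
    + rewrite (mono_mulP _ _ env_inf). destruct (mono_mul m' m) as [u |]; cbn.
      * now rewrite gr_mul1r.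
      * rewrite <- (expt0 (br (word_tan v) (word_tan w))). f_equal. ring.
    + rewrite (morph_opp inj_morph), (morph_mul inj_morph). ring.
Qed.

(** From $ab=bac$, the correction $c$ is inserted into the tail first, and [a] in front of the
    result. *)
Lemma insertP (n : nat) (a : letter) (l : list letter) :
  word_val (insert n a l) = (letter_val a ** word_val l)%lie.
Proof.
  revert a l. induction n as [| n IH]; intros a l; [reflexivity|].
  destruct l as [| b l]; [reflexivity|]. cbn.
  destruct (same_key a b) eqn:Hk; [now apply mergeP|].
  destruct (letter_ltb a b); [reflexivity|].
  destruct (swappable a b) eqn:Hs; [|reflexivity]. cbn.
  assert (Hfold : forall c, word_val (fold_right (insert n) l c)
                            = (word_val c ** word_val l)%lie).
  { induction c as [| x c IHc]; cbn.
    - now rewrite gr_mul1l.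
    - now rewrite IH, IHc, gr_mulA. }
  rewrite IH, Hfold, !(gr_mulA (letter_val a)), (commutatorP Hs), !gr_mulA.
  reflexivity.
Qed.

Lemma collectP (n : nat) (l : list letter) : word_val (collect n l) = word_val l.
Proof.
  unfold collect. induction l as [| a l IH]; cbn; [reflexivity|].
  now rewrite insertP, IH.
Qed.

(** The reflection principle: an identity in the group follows from an equality of two computed
    lists. *)
Lemma collect_eq (n : nat) (l l' : list letter) :
  collect n l = collect n l' -> word_val l = word_val l'.
Proof. intros H. now rewrite <- (collectP n l), H, collectP. Qed.

End Words.

(** * The product formula of order four *)

Lemma expt_sum4 (A : tangent G) (a b c d : R) :
  expt A (a + b + c + d) = (expt A a ** (expt A b ** (expt A c ** expt A d)))%lie.
Proof. now rewrite !exptD, <- !gr_mulA. Qed.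

Lemma zassenhaus4 (X Y : tangent G) (d1 d2 d3 d4 : D R) :
  let Z := br X Y in
  let s := d1 + d2 + d3 + d4 in
  expt (X + Y)%tangent s
  = (expt X s ** expt Y s
     ** expt Z (- (d1 * d2 + d1 * d3 + d1 * d4 + d2 * d3 + d2 * d4 + d3 * d4))
     ** expt (br (X + natr R 2 *: Y)%tangent Z)
          (d1 * d2 * d3 + d1 * d2 * d4 + d1 * d3 * d4 + d2 * d3 * d4)
     ** expt (- br X (br X Z) - natr R 3 *: br X (br Y Z)
                - natr R 3 *: br Y (br Y Z))%tangent
          (d1 * d2 * d3 * d4))%lie.
Proof.
  intros Z s.
  pose proof (Dval_sq d1) as H1. pose proof (Dval_sq d2) as H2.
  pose proof (Dval_sq d3) as H3. pose proof (Dval_sq d4) as H4.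
  (* The bracket with a sum is expanded as its defining group commutator, where the sum turns into a
     product; this takes the place of linearity of the bracket. *)
  assert (HB3 : forall r t, r * r = 0 -> t * t = 0 ->
    expt (br (X + natr R 2 *: Y)%tangent Z) (r * t)
    = (expt X r ** (expt Y (natr R 2 * r) ** (expt Z t
       ** (expt X (- r) ** (expt Y (natr R 2 * - r) ** expt Z (- t))))))%lie).
  { intros r t Hr Ht. rewrite expt_br, !expt_tadd, !exptZ by ring [Hr Ht].
    now rewrite <- !gr_mulA. }
  assert (HB4 : expt (- br X (br X Z) - natr R 3 *: br X (br Y Z)
                        - natr R 3 *: br Y (br Y Z))%tangent (d1 * (d2 * (d3 * d4)))
    = (expt (br X (br X Z)) (- (d1 * d2 * d3 * d4))
       ** (expt (br Y (br X Z)) (natr R 3 * - (d1 * d2 * d3 * d4))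
           ** expt (br Y (br Y Z)) (natr R 3 * - (d1 * d2 * d3 * d4))))%lie).
  { rewrite !expt_tadd, !exptZ by ring [H1].
    (* The parameter takes the shape $a(bc)$ of [expt_jacobi], with $a=-3d_1$, $b=d_2$ and
       $c=d_3d_4$. *)
    replace (natr R 3 * - (d1 * d2 * d3 * d4))
      with ((natr R 3 * - d1) * (d2 * (d3 * d4))) by ring.
    rewrite <- (@expt_jacobi X Y) by ring [H1 H2 H3].
    rewrite <- gr_mulA.
    repeat apply (f_equal2 (@gr_mul G)); apply f_equal; ring. }
  set (m := fun b1 b2 b3 b4 : bool => [b1; b2; b3; b4]).
  set (m1 := m true false false false). set (m2 := m false true false false).
  set (m3 := m false false true false). set (m4 := m false false false true).
  set (m12 := m true true false false). set (m13 := m true false true false).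
  set (m14 := m true false false true). set (m23 := m false true true false).
  set (m24 := m false true false true). set (m34 := m false false true true).
  set (wX := Gen false). set (wY := Gen true). set (wZ := Br wX wY).
  (* The right side of [HB3], with [a] and [b] the monomials of $r$ and $t$. *)
  set (B3 := fun a b => [Letter wX 1 a; Letter wY 2 a; Letter wZ 1 b;
                         Letter wX (-1) a; Letter wY (-2) a; Letter wZ (-1) b]).
  assert (Henv : Forall (fun x => x * x = 0) [d1 : R; d2 : R; d3 : R; d4 : R])
    by (repeat constructor; assumption).
  (* The first list splits $(X+Y)_{d_i}$ as $X_{d_i}.Y_{d_i}$. Fuel $40$ suffices for both lists to
     collect to the same one, as [vm_compute] checks. *)
  assert (E := @collect_eq X Y _ Henv 40
    (flat_map (fun a => [Letter wX 1 a; Letter wY 1 a]) [m1; m2; m3; m4])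
    (map (Letter wX 1) [m1; m2; m3; m4] ++ map (Letter wY 1) [m1; m2; m3; m4]
     ++ map (Letter wZ (-1)) [m12; m13; m14; m23; m24; m34]
     ++ B3 m1 m23 ++ B3 m1 m24 ++ B3 m1 m34 ++ B3 m2 m34
     ++ [Letter (Br wX (Br wX wZ)) (-1) (m true true true true);
         Letter (Br wY (Br wX wZ)) (-3) (m true true true true);
         Letter (Br wY (Br wY wZ)) (-3) (m true true true true)])
    ltac:(vm_compute; reflexivity)).
  cbn in E. rewrite !gr_mul1r in E.
  refine (eq_trans _ (eq_trans E _)).
  - unfold s. rewrite expt_sum4, !expt_tadd, <- !gr_mulA by assumption.
    repeat apply (f_equal2 (@gr_mul G)); apply (f_equal (expt _)); cbn; ring.
  (* Cubic monomials become $d_i(d_jd_k)$ and the quartic one $d_1(d_2(d_3d_4))$, to match [HB3] and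
     [HB4]. *)
  - rewrite <- !(Rmul_assoc (cr_theory R) _ _ (Dval d3)),
      <- !(Rmul_assoc (cr_theory R) _ _ (Dval d4)).
    replace (- (d1 * d2 + d1 * d3 + d1 * d4 + d2 * d3 + d2 * d4 + d3 * d4))
      with (- (d1 * d2) + - (d1 * d3) + - (d1 * d4) + - (d2 * d3) + - (d2 * d4)
            + - (d3 * d4)) by ring.
    unfold s. rewrite !expt_sum4, !(exptD Z).
    rewrite HB4, !HB3, <- !gr_mulA by ring [H1 H2 H3 H4].
    repeat apply (f_equal2 (@gr_mul G)); apply (f_equal (expt _)); cbn; ring.
Qed.

End Exponential.

Theorem theorem36 (R : line) (G : lie_group R) (G_regular : regular G)
    (exp : tangent G -> G) (exp_spec : is_exponential exp)
    (br : tangent G -> tangent G -> tangent G) (br_spec : is_lie_bracket br)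
    (X Y : tangent G) (d1 d2 d3 d4 : D R) :
  let s : R := (d1 + d2 + d3 + d4)%line in
  let B3 : tangent G := br (X + natr R 2 *: Y)%tangent (br X Y) in
  let B4 : tangent G :=
    (- br X (br X (br X Y)) - natr R 3 *: br X (br Y (br X Y))
       - natr R 3 *: br Y (br Y (br X Y)))%tangent in
  exp (s *: (X + Y))%tangent
  = (exp (s *: X)%tangent
     ** exp (s *: Y)%tangent
     ** exp (- (d1 * d2 + d1 * d3 + d1 * d4 + d2 * d3 + d2 * d4 + d3 * d4)
               *: br X Y)%tangent
     ** exp ((d1 * d2 * d3 + d1 * d2 * d4 + d1 * d3 * d4 + d2 * d3 * d4)
               *: B3)%tangent
     ** exp ((d1 * d2 * d3 * d4) *: B4)%tangent)%lie
  /\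
  exp (s *: (X + Y))%tangent
  = (exp (s *: X)%tangent
     ** exp (s *: Y)%tangent
     ** exp (- (s ^ 2 / 2) *: br X Y)%tangent
     ** exp ((s ^ 3 / 6) *: B3)%tangent
     ** exp ((s ^ 4 / 24) *: B4)%tangent)%lie.
Proof.
  intros s B3 B4.
  pose proof (zassenhaus4 exp_spec br_spec X Y d1 d2 d3 d4) as H.
  (* [expt A r] unfolds to [exp (r *: A)], so the first product is [H] up to conversion. *)
  split; [exact H|].
  destruct (power_sum4 d1 d2 d3 d4) as (E2 & E3 & E4).
  unfold s. rewrite E2, E3, E4. exact H.
Qed.
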